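(* Let $K$ be a compact metric space, and let $X$ be a separable almost-CL-space. Then $C(K, X)$ has the Mazur-Ulam property.
   Context: All spaces are over the real field. For a Banach space $X$, $B_X$ and $S_X$ are its closed unit ball and unit sphere. A convex subset $C$ of $S_X$ is a maximal convex subset of $S_X$ if it is not properly contained in any other convex subset of $S_X$. A Banach space $X$ is an almost-CL-space if for every maximal convex subset $C$ of $S_X$ one has $B_X=\overline{\mathrm{co}}(C\cup -C)$ (closed convex hull). $C(K,X)$ is the Banach space of continuous functions from $K$ into $X$ with the supremum norm. A Banach space $Z$ has the Mazur-Ulam property (MUP) if for every Banach space $Y$, every surjective isometry $T:S_Z\to S_Y$ between the unit spheres is the restriction of a linear isometry between the two spaces $Z$ and $Y$. *)

(* Defs.v *)
From HB Require Import structures.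
From mathcomp Require Import all_boot all_order all_algebra.
From mathcomp Require Import all_classical all_reals all_analysis.
From mathcomp Require Import lra.

Set Implicit Arguments.
Unset Strict Implicit.
Unset Printing Implicit Defensive.

Import Order.TTheory GRing.Theory Num.Theory.
Import numFieldNormedType.Exports.

Local Open Scope classical_set_scope.
Local Open Scope ring_scope.

Definition separable (T : topologicalType) : Prop :=
  exists A : set T, countable A /\ dense A.

Section unit_ball_and_sphere.
Context {R : realType}.

Definition unit_ball (X : normedModType R) : set X := [set x | `|x| <= 1].

Definition unit_sphere (X : normedModType R) : set X := [set x | `|x| = 1].

Arguments unit_ball X : clear implicits.
Arguments unit_sphere X : clear implicits.

Definition maximal_convex_subset (X : normedModType R) (A C : set X) : Prop :=
  [/\ convex_set C, C `<=` A &
      forall D : set X, convex_set D -> D `<=` A -> ~ (C `<` D)].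

Definition convex_hull (X : normedModType R) (A : set X) : set X :=
  smallest (@convex_set R X) A.

Definition almost_CL_space (X : completeNormedModType R) : Prop :=
  forall C : set X, maximal_convex_subset (unit_sphere X) C ->
    unit_ball X = closure (convex_hull (C `|` -%R @` C)).

(* An isometry of S_Z onto S_Y is given by a map on all of Z of which only the
   restriction to S_Z matters; every map S_Z -> S_Y extends to such a map. *)
Definition Mazur_Ulam_property (Z : completeNormedModType R) : Prop :=
  forall (Y : completeNormedModType R) (T : Z -> Y),
    T @` unit_sphere Z = unit_sphere Y ->
    (forall x y, unit_sphere Z x -> unit_sphere Z y ->
       `|T x - T y| = `|x - y|) ->
    exists F : {linear Z -> Y},
      [/\ forall z, `|F z| = `|z|,
          range F = [set: Y] &
          forall z, unit_sphere Z z -> T z = F z].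

End unit_ball_and_sphere.

Arguments unit_ball {R} X.
Arguments unit_sphere {R} X.

(* The compactness proof is a parameter of the type because it is what makes
   the supremum norm finite. *)
Definition cspace (R : realType) (K : topologicalType)
    (cK : compact [set: K]) (X : normedModType R) : Type :=
  continuousType K X.

Section cspace_normedModule.
Context {R : realType} {K : topologicalType} (cK : compact [set: K]).
Context (X : normedModType R).
Local Notation CKX := (cspace cK X).
Implicit Types f g : CKX.

HB.instance Definition _ := Choice.copy CKX (continuousType K X).

Lemma cspace_continuous f : continuous f.
Proof. exact: (@cts_fun _ _ (f : continuousType K X)). Qed.

Definition cspace_mk (f : K -> X) (cf : continuous f) : CKX :=
  mkcts cf : continuousType K X.

Lemma cspace_mkE (f : K -> X) (cf : continuous f) : cspace_mk cf = f :> (_ -> _).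
Proof. by []. Qed.

Lemma cspaceP f g : f =1 g -> f = g.
Proof. by move=> fg; apply/(@continuousEP K X). Qed.

Let zero_continuous : continuous (fun _ : K => 0 : X).
Proof. by move=> x; exact: cvg_cst. Qed.

Let opp_continuous f : continuous (fun x => - f x).
Proof. by move=> x; apply: cvgN; exact: cspace_continuous. Qed.

Let add_continuous f g : continuous (fun x => f x + g x).
Proof. by move=> x; apply: cvgD; exact: cspace_continuous. Qed.

Let scale_continuous (a : R) f : continuous (fun x => a *: f x).
Proof. by move=> x; apply: cvgZr; exact: cspace_continuous. Qed.

Let zero : CKX := cspace_mk zero_continuous.
Let opp f : CKX := cspace_mk (@opp_continuous f).
Let add f g : CKX := cspace_mk (@add_continuous f g).
Let scale a f : CKX := cspace_mk (@scale_continuous a f).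

Let addA : associative add.
Proof. by move=> f g h; apply: cspaceP => x; exact: addrA. Qed.

Let addC : commutative add.
Proof. by move=> f g; apply: cspaceP => x; exact: addrC. Qed.

Let add0 : left_id zero add.
Proof. by move=> f; apply: cspaceP => x; exact: add0r. Qed.

Let addN : left_inverse zero opp add.
Proof. by move=> f; apply: cspaceP => x; exact: addNr. Qed.

HB.instance Definition _ := GRing.isZmodule.Build CKX addA addC add0 addN.

Let scaleA a b f : scale a (scale b f) = scale (a * b) f.
Proof. by apply: cspaceP => x; exact: scalerA. Qed.

Let scale1 : left_id 1 scale.
Proof. by move=> f; apply: cspaceP => x; exact: scale1r. Qed.

Let scaleDr : right_distributive scale +%R.
Proof. by move=> a f g; apply: cspaceP => x; exact: scalerDr. Qed.

Let scaleDl f : {morph scale^~ f : a b / a + b}.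
Proof. by move=> a b; apply: cspaceP => x; exact: scalerDl. Qed.

HB.instance Definition _ :=
  GRing.Zmodule_isLmodule.Build R CKX scaleA scale1 scaleDr scaleDl.

Lemma cspace0E x : (0 : CKX) x = 0. Proof. by []. Qed.
Lemma cspaceNE f x : (- f) x = - f x. Proof. by []. Qed.
Lemma cspaceDE f g x : (f + g) x = f x + g x. Proof. by []. Qed.
Lemma cspaceBE f g x : (f - g) x = f x - g x. Proof. by []. Qed.
Lemma cspaceZE a f x : (a *: f) x = a *: f x. Proof. by []. Qed.

(* For empty K this is sup set0 = 0. *)
Definition sup_norm f : R := sup (range (fun x => `|f x|)).

Lemma sup_norm_has_ubound f : has_ubound (range (fun x => `|f x|)).
Proof.
have cf : compact (range f).
  apply: continuous_compact => //; apply: continuous_subspaceT.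
  exact: cspace_continuous.
have [M [_ fM]] := compact_bounded cf.
exists (M + 1) => _ [x _ <-].
by apply: (fM (M + 1)); rewrite ?ltrDl//; exists x.
Qed.

Lemma le_sup_norm f x : `|f x| <= sup_norm f.
Proof. by apply: ub_le_sup; [exact: sup_norm_has_ubound|exists x]. Qed.

Lemma sup_norm_ge0 f : 0 <= sup_norm f.
Proof.
have [/eqP K0|/set0P[_ [x _ _]]] := boolP (range (fun x => `|f x|) == set0).
  by rewrite /sup_norm K0 sup0.
exact: le_trans (normr_ge0 _) (le_sup_norm f x).
Qed.

Lemma sup_norm_le f M : 0 <= M -> (sup_norm f <= M) <-> (forall x, `|f x| <= M).
Proof.
move=> M0; split=> [fM x|fM]; first exact: le_trans (le_sup_norm f x) fM.
have [/eqP K0|/set0P K0] := boolP (range (fun x => `|f x|) == set0).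
  by rewrite /sup_norm K0 sup0.
by apply: ge_sup => // _ [x _ <-].
Qed.

Let sup_normD f g : sup_norm (f + g) <= sup_norm f + sup_norm g.
Proof.
apply/sup_norm_le => [|x]; first by rewrite addr_ge0 ?sup_norm_ge0.
by rewrite cspaceDE (le_trans (ler_normD _ _))// lerD ?le_sup_norm.
Qed.

Let sup_normZ (a : R) f : sup_norm (a *: f) = `|a| * sup_norm f.
Proof.
have Z (b : R) g : sup_norm (b *: g) <= `|b| * sup_norm g.
  apply/sup_norm_le => [|x]; first by rewrite mulr_ge0 ?sup_norm_ge0.
  by rewrite cspaceZE normrZ ler_wpM2l ?le_sup_norm.
apply/eqP; rewrite eq_le Z/=.
have [->|a0] := eqVneq a 0; first by rewrite normr0 mul0r sup_norm_ge0.
rewrite -ler_pdivlMl ?normr_gt0// -normfV.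
by rewrite -{1}[f](scale1r) -(mulVf a0) -scalerA Z.
Qed.

Let sup_norm0_eq0 f : sup_norm f = 0 -> f = 0.
Proof.
move=> f0; apply: cspaceP => x; apply/eqP.
by rewrite cspace0E -normr_le0 -f0 le_sup_norm.
Qed.

HB.instance Definition _ :=
  Lmodule_isNormed.Build R CKX sup_normD sup_normZ sup_norm0_eq0.

Lemma cspace_normE f : `|f| = sup_norm f. Proof. by []. Qed.

End cspace_normedModule.

Section cspace_complete.
Context {R : realType} {K : topologicalType} (cK : compact [set: K]).
Context (X : completeNormedModType R).
Local Notation CKX := (cspace cK X).

Let cspace_cauchy_cvg (F : set_system CKX) :
  ProperFilter F -> cauchy F -> cvg F.
Proof.
move=> FF Fc.
have Fc' e : 0 < e -> exists f : CKX, F [set g : CKX | `|f - g| < e].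
  move=> e0; have /cauchyP/(_ e e0)[f Ff] := Fc.
  by exists f; move: Ff; rewrite -ball_normE.
have Fx x : cvg (fmap (fun f : CKX => f x) F).
  apply/cauchy_cvgP/cauchyP => e e0.
  have [f Ff] := Fc' e e0; exists (f x).
  rewrite -ball_normE; suff : F [set g : CKX | `|f x - g x| < e] by [].
  apply: filterS Ff => g /= fg.
  by apply: le_lt_trans fg; rewrite -cspaceBE le_sup_norm.
pose l x : X := lim (fmap (fun f : CKX => f x) F).
have lP e : 0 < e -> F [set g : CKX | forall x, `|l x - g x| <= e].
  move=> e0; have e20 : 0 < e / 2 by rewrite divr_gt0.
  have [f Ff] := Fc' _ e20.
  apply: filterS (Ff) => g /= fg x.
  have cl : closed [set y : X | `|y - g x| <= e].
    have -> : [set y : X | `|y - g x| <= e] = (fun y => `|y - g x|) @^-1` [set r | r <= e].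
      by [].
    apply: preimage_closed; last exact: closed_le.
    move=> y _; apply: cvg_norm; apply: cvgB; [exact: cvg_id|exact: cvg_cst].
  apply: (@closed_cvg _ _ F FF (fun h : CKX => h x) _ cl) (Fx x).
  apply: filterS Ff => h /= fh.
  rewrite -(subrKA (f x)) (le_trans (ler_normD _ _))// (splitr e) lerD//.
    by rewrite distrC; exact: le_trans (le_sup_norm (f - h) x) (ltW fh).
  exact: le_trans (le_sup_norm (f - g) x) (ltW fg).
have lc : continuous l.
  move=> x; apply/cvgrPdist_lt => e e0.
  have e30 : 0 < e / 3%:R by rewrite divr_gt0.
  have [f lf] := filter_ex (lP _ e30).
  have /cvgrPdist_lt/(_ _ e30) := @cspace_continuous _ _ _ _ f x.
  apply: filterS => y fxy.
  have -> : l x - l y = (l x - f x) + (f x - f y) + (f y - l y).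
    by rewrite !subrKA.
  have -> : e = e / 3%:R + e / 3%:R + e / 3%:R.
    by lra.
  rewrite (le_lt_trans (ler_normD _ _))// ltr_leD//; last by rewrite distrC lf.
  by rewrite (le_lt_trans (ler_normD _ _))// ler_ltD.
apply/cvg_ex; exists (cspace_mk cK lc); apply/cvgrPdist_le => e e0.
apply: filterS (lP _ e0) => g lg.
by rewrite cspace_normE; apply/sup_norm_le => //; exact: ltW.
Qed.

HB.instance Definition _ := Uniform_isComplete.Build CKX cspace_cauchy_cvg.

End cspace_complete.

(* Main.v *)
Require Import Defs.
From HB Require Import structures.
From mathcomp Require Import all_boot all_order all_algebra.
From mathcomp Require Import all_classical all_reals all_analysis.
From mathcomp Require Import lra.

Set Implicit Arguments.
Unset Strict Implicit.
Unset Printing Implicit Defensive.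

Import Order.TTheory GRing.Theory Num.Theory.
Import numFieldNormedType.Exports.

Local Open Scope classical_set_scope.
Local Open Scope ring_scope.

(** Write [S] for the unit sphere and let the star of a unit vector [h] be the
set of the [x] in [S] with [|h + x| = 2].  Since [|h + x| = |h - (- x)|], the
sets [- star h] are determined by the metric of [S], so a surjective isometry
[T : S_V -> S_W] carries [- star h] onto [- star (T h)] and respects the
inclusions between stars.  In particular it preserves the stars that are minimal
for inclusion.  A minimal star is automatically convex
([minimal_star_convex]), and two minimal stars coincide as soon as one contains
the centre of the other ([minimal_star_eq]); the latter gives
[T (- h) \in - star (T h)] the force of an equality of stars, so that [T] maps
[star h] into [star (T h)] as well ([sphere_isometry_image_star]).

Let [D = star h] be minimal and suppose that every [x] in [S] lies almost on a
metric segment of length 2 between [D] and [- D], that is, the sum of the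
distances from [x] to [D] and to [- D] is at most 2.  The sublinear function
[p_D y = inf (|y + s c| - s)], for [c] in [D] and [s > 0], satisfies
[p_D x <= dist x (- D) - 1] and [p_D (- x) <= dist x D - 1], hence
[p_D x + p_D (- x) <= 0]: it is odd, so linear, and [p_D x] is
[dist x (- D) - 1] on [S].  That is a metric quantity, whence
[p_(T D) (T x) = p_D x].  If such stars cover [S_V], then their images cover
[S_W], the functionals [p_(T D)] separate the points of [W], and the positively
homogeneous extension of [T] is linear ([Mazur_Ulam_of_star_cover]).

Such a cover exists for [C(K, X)].  In a separable space a maximal convex
subset [C] of [S] is the star of [h], the sum of the [2 ^ - (n + 1) c_n] over
a dense sequence of points [c_n] of [C] ([maximal_convex_is_star]), and then that
star is minimal.  If [x] is close to [s c - t d] with [s + t = 1] and [c], [d] in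
[C], then [|x - c|] and [|x + d|] are at most about [2 t] and [2 s], so the
almost-CL property provides the metric segments
([separable_almost_CL_star_cover]).  The cover passes from [X] to [C(K, X)]
([star_cover_cspace]): for a bump function [phi] that equals 1 at [t] only, the
star of [phi x] is the set of the [f] in [S] with [f t] in [star x]; and a
function [f] is moved to one that takes a prescribed value [c] at [t], at a cost
of about [|f t - c|], by blending [f] with [c] in a small ball around [t]. *)

(** * Identities between linear combinations *)

(** Replacing vectors by their coordinate functions reduces an identity between
linear combinations to one between their coefficients. *)
Lemma linear_combination4 (R : realType) (V : lmodType R) (x y z w : V) :
  exists f : R -> R -> R -> R -> V,
    [/\ x = f 1 0 0 0, y = f 0 1 0 0, z = f 0 0 1 0 & w = f 0 0 0 1] /\
    [/\ 0 = f 0 0 0 0,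
     forall a b c d, - f a b c d = f (- a) (- b) (- c) (- d),
     forall a b c d a' b' c' d',
       f a b c d + f a' b' c' d' = f (a + a') (b + b') (c + c') (d + d') &
     forall k a b c d, k *: f a b c d = f (k * a) (k * b) (k * c) (k * d)].
Proof.
exists (fun a b c d => a *: x + b *: y + (c *: z + d *: w)).
split; split=> *; rewrite ?scale0r ?scale1r ?addr0 ?add0r //.
- by rewrite !opprD !scaleNr.
- by rewrite !scalerDl addrACA [X in X + _]addrACA [X in _ + X]addrACA.
- by rewrite !scalerDr !scalerA.
Qed.

(** Proves an equality between linear combinations of at most four vectors; the
list of the vectors is padded by repetition. *)
Ltac linear_identity x y z w :=
  let f := fresh in
  let Ex := fresh in let Ey := fresh in let Ez := fresh in let Ew := fresh in
  let E0 := fresh in let EN := fresh in let ED := fresh in let EZ := fresh in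
  have [f [[Ex Ey Ez Ew] [E0 EN ED EZ]]] := linear_combination4 x y z w;
  rewrite ?[in LHS]Ex ?[in RHS]Ex ?[in LHS]Ey ?[in RHS]Ey
    ?[in LHS]Ez ?[in RHS]Ez ?[in LHS]Ew ?[in RHS]Ew
    ?[in LHS]E0 ?[in RHS]E0 ?(EZ, EN, ED);
  congr (f _ _ _ _); lra.

(** * Convex sets *)

Section convexity.
Context {R : realType} {V : normedModType R}.
Implicit Types (C D : set V) (x y z : V) (s t : R).

Lemma convex_setP C : convex_set C <->
  (forall x y s t, C x -> C y -> 0 <= s -> 0 <= t -> s + t = 1 ->
    C (s *: x + t *: y)).
Proof.
split=> [cC x y s t Cx Cy s0 t0 st|cC x y l /set_mem Cx /set_mem Cy].
- have s1 : s <= 1 by lra.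
  have := cC x y (Itv01 s0 s1) (mem_set Cx) (mem_set Cy).
  move=> /set_mem; rewrite /conv/=.
  suff -> : t = 1 - s by [].
  by lra.
- apply/mem_set; apply: cC => //.
    by rewrite /unstable.onem subr_ge0.
  by rewrite unstable.add_onemK.
Qed.

Lemma convex_cone C x y s t : convex_set C -> C x -> C y -> 0 <= s -> 0 <= t ->
  exists2 z, C z & s *: x + t *: y = (s + t) *: z.
Proof.
move=> /convex_setP cC Cx Cy s0 t0.
have [st0|st_neq0] := eqVneq (s + t) 0.
  exists x => //; have [-> ->] : s = 0 /\ t = 0 by lra.
  by rewrite addr0 !scale0r addr0.
exists ((s / (s + t)) *: x + (t / (s + t)) *: y).
  by apply: cC; rewrite ?divr_ge0 ?addr_ge0// -mulrDl divff.
by rewrite scalerDr !scalerA !(mulrC (s + t)) !divfK.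
Qed.
End convexity.

(** * Stars *)

Section star.
Context {R : realType} {V : normedModType R}.
Implicit Types (C D : set V) (x y z h k : V) (s t : R).

Definition star h : set V := [set x | `|x| = 1 /\ `|h + x| = 2].

(** Minimality refers to the inclusion order only, which makes the notion
invariant under isometries of spheres. *)
Definition minimal_star h :=
  `|h| = 1 /\ forall k, `|k| = 1 -> star k `<=` star h -> star h `<=` star k.

Lemma norm_double x : `|2 *: x| = 2 * `|x|.
Proof. by rewrite normrZ ger0_norm. Qed.

Lemma star_self h : `|h| = 1 -> star h h.
Proof.
move=> h1; split=> //; have -> : h + h = 2 *: h by linear_identity h h h h.
by rewrite norm_double h1 mulr1.
Qed.

Lemma star_sphere h : star h `<=` unit_sphere _.
Proof. by move=> x []. Qed.

Lemma star_nonempty h : `|h| = 1 -> star h !=set0.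
Proof. by move=> h1; exists h; exact: star_self. Qed.

Lemma starC h x : `|h| = 1 -> star h x -> star x h.
Proof. by move=> h1 [x1 hx]; split=> //; rewrite addrC. Qed.

Lemma starN h x : star h (- x) <-> star (- h) x.
Proof. by rewrite /star/= normrN -[`|- h + x|]normrN opprD opprK. Qed.

Lemma norm_le_star h x : `|h| = 1 -> `|x| = 1 -> 2 <= `|h + x| -> star h x.
Proof.
move=> h1 x1 hx; split=> //; apply/le_anti; rewrite hx andbT.
by rewrite (le_trans (ler_normD _ _))// h1 x1; lra.
Qed.

(** If [z] is in the star of the midpoint [w] of [h] and [x], then
[4 = |(h + z) + (x + z)|], which leaves no room for [|h + z|] or [|x + z|] to be
less than 2. *)
Lemma midpoint_star h x : `|h| = 1 -> star h x ->
  `|2^-1 *: (h + x)| = 1 /\ star (2^-1 *: (h + x)) `<=` star h `&` star x.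
Proof.
move=> h1 [x1 hx]; have w1 : `|2^-1 *: (h + x)| = 1.
  by rewrite normrZ hx ger0_norm// mulVf.
split=> // z [z1 wz].
have : `|2 *: (2^-1 *: (h + x) + z)| = 4 by rewrite norm_double wz; lra.
have -> : 2 *: (2^-1 *: (h + x) + z) = (h + z) + (x + z) by linear_identity h x z z.
move=> hxz; have := ler_normD (h + z) (x + z).
have := ler_normD h z; have := ler_normD x z; rewrite hxz z1 h1 x1 => *.
by split; apply: norm_le_star => //; lra.
Qed.

Lemma minimal_star_midpoint h x : minimal_star h -> star h x ->
  star h `<=` star (2^-1 *: (h + x)).
Proof.
move=> [h1 minh] hx; have [w1 wsub] := midpoint_star h1 hx.
by apply: minh => // z /wsub[].
Qed.

(** The star of the midpoint of [h] and [k] is included in both stars, hence equal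
to both by minimality. *)
Lemma minimal_star_eq h k : minimal_star h -> minimal_star k -> star h k ->
  star h = star k.
Proof.
move=> mh mk hk; have [h1 _] := mh; have [k1 _] := mk.
have [_ wsub] := midpoint_star h1 hk.
have whk := minimal_star_midpoint mh hk.
have wkh := minimal_star_midpoint mk (starC h1 hk).
apply/seteqP; split => z.
  by move=> /whk/wsub[].
by rewrite addrC in wkh; move=> /wkh/wsub[].
Qed.

(** For [u] and [v] in the star of [h], the star of the midpoint of [h] and [u] is
that of [h], so it contains [v] and [|h + u + 2 v| = 4].  This vector is
[h + (s u + t v)] plus a vector of norm at most 2. *)
Lemma minimal_star_convex h : minimal_star h -> convex_set (star h).
Proof.
move=> mh; have [h1 _] := mh; apply/convex_setP => u v s t hu hv s0 t0 st.
have [_] := minimal_star_midpoint mh hu hv; have [u1 _] := hu; have [v1 _] := hv.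
move=> wv; have : `|2 *: (2^-1 *: (h + u) + v)| = 4.
  by rewrite norm_double wv; lra.
have -> : 2 *: (2^-1 *: (h + u) + v) =
    (h + (s *: u + t *: v)) + ((1 - s) *: u + (2 - t) *: v).
  by linear_identity h u v v.
move=> huv; have := ler_normD (h + (s *: u + t *: v)) ((1 - s) *: u + (2 - t) *: v).
have := ler_normD ((1 - s) *: u) ((2 - t) *: v).
have := ler_normD (s *: u) (t *: v).
have := ler_normD h (s *: u + t *: v).
rewrite huv !normrZ u1 v1 h1 !mulr1 !ger0_norm; [|lra..] => *.
by apply: norm_le_star => //; [apply/le_anti/andP; split|]; lra.
Qed.

Lemma minimal_starN h : minimal_star h -> minimal_star (- h).
Proof.
move=> [h1 mh]; split; first by rewrite normrN.
move=> k k1 khN x /starN hx.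
have hk : star h `<=` star (- k).
  apply: mh; rewrite ?normrN// => y /starN/khN/starN.
  by rewrite opprK.
by move: hx => /hk/starN; rewrite opprK.
Qed.

(** If the star of [k] is included in the convex set [star h], then [k] is in that
set, and convexity puts every segment from [k] to a point of it on the sphere. *)
Lemma maximal_convex_minimal_star h :
  `|h| = 1 -> maximal_convex_subset (unit_sphere V) (star h) -> minimal_star h.
Proof.
move=> h1 [/convex_setP cC CS _]; split=> // k k1 kh x hx.
have /CS w1 : star h (2^-1 *: k + 2^-1 *: x).
  by apply: cC => //; [exact/kh/star_self|lra].
apply: norm_le_star => //; first by case: hx.
have -> : k + x = 2 *: (2^-1 *: k + 2^-1 *: x) by linear_identity k x k k.
by rewrite norm_double w1 mulr1.
Qed.

End star.

(** * The functional supporting a face *)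

Section support.
Context {R : realType} {V : normedModType R}.

(** What is retained of the density of the convex hull of [D] and [- D] in the
unit ball: [x] is almost on a metric segment of length 2 between [D] and [- D].
Only distances between points of the sphere are involved, so the property can be
carried by isometries of spheres. *)
Definition sphere_between (D : set V) :=
  forall x, `|x| = 1 -> forall e, 0 < e ->
    exists c d, [/\ D c, D d & `|x - c| + `|x + d| <= 2 + e].

Definition generating_face (D : set V) :=
  [/\ D `<=` unit_sphere V, D !=set0, convex_set D & sphere_between D].

(** For convex [D] in the unit sphere, the largest sublinear function below the
norm that is at most [-1] on [- D].  When [D] is a generating face it is linear
and is thus the functional of norm 1 that supports the ball along [D]. *)
Definition support_functional (D : set V) (y : V) : R :=
  inf [set r | exists c s, [/\ D c, 0 < s & r = `|y + s *: c| - s]].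

Variable D : set V.
Hypothesis faceD : generating_face D.
Let D1 : D `<=` unit_sphere V. Proof. by case: faceD. Qed.
Let D0 : D !=set0. Proof. by case: faceD. Qed.
Let cD : convex_set D. Proof. by case: faceD. Qed.
Let btw : sphere_between D. Proof. by case: faceD. Qed.
Local Notation support := (support_functional D).
Implicit Types (x y z c : V) (s t e : R).

Lemma normr_support_arg y c s : D c -> 0 < s -> - `|y| <= `|y + s *: c| - s.
Proof.
move=> Dc s0; have := ler_normB (y + s *: c) y.
by rewrite addrAC subrr add0r normrZ (D1 Dc) mulr1 gtr0_norm//; lra.
Qed.

Lemma support_le y c s : D c -> 0 < s -> support y <= `|y + s *: c| - s.
Proof.
move=> Dc s0; apply: ge_inf; last by exists c, s.
by exists (- `|y|) => _ [d [t [Dd t0 ->]]]; exact: normr_support_arg.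
Qed.

Lemma support_ge y m :
  (forall c s, D c -> 0 < s -> m <= `|y + s *: c| - s) -> m <= support y.
Proof.
move=> my; apply: lb_le_inf; last by move=> _ [c [s [Dc s0 ->]]]; exact: my.
by have [c Dc] := D0; exists (`|y + 1 *: c| - 1), c, 1.
Qed.

Lemma support_le_norm y : support y <= `|y|.
Proof.
have [c Dc] := D0; apply: le_trans (support_le _ Dc ltr01) _.
rewrite lerBlDr (le_trans (ler_normD _ _))// scale1r (D1 Dc).
by [].
Qed.

Lemma support0 : support 0 = 0.
Proof.
apply/le_anti/andP; split; first by rewrite -(normr0 V) support_le_norm.
by apply: support_ge => c s Dc s0; rewrite -oppr0 -(normr0 V) normr_support_arg.
Qed.

(** This is where convexity of [D] enters: [s c + t d] is [s + t] times a point
of [D]. *)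
Lemma support_subadditive x y : support (x + y) <= support x + support y.
Proof.
rewrite -lerBlDr; apply: support_ge => c s Dc s0.
rewrite lerBlDr -lerBlDl; apply: support_ge => d t Dd t0.
have [e De csd] := convex_cone cD Dc Dd (ltW s0) (ltW t0).
have := support_le (x + y) De (addr_gt0 s0 t0).
rewrite -csd addrACA.
by have := ler_normD (x + s *: c) (y + t *: d); lra.
Qed.

Lemma support_ge_homo t y : 0 < t -> support (t *: y) <= t * support y.
Proof.
move=> t0; rewrite -ler_pdivrMl//; apply: support_ge => c s Dc s0.
rewrite ler_pdivrMl// mulrBr -[in leRHS](gtr0_norm t0) -normrZ scalerDr scalerA.
by rewrite gtr0_norm//; apply: support_le => //; exact: mulr_gt0.
Qed.

Lemma support_homo t y : 0 < t -> support (t *: y) = t * support y.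
Proof.
move=> t0; apply/le_anti; rewrite support_ge_homo//=.
rewrite -ler_pdivlMl// -{1}[y](scalerK (lt0r_neq0 t0)).
by rewrite support_ge_homo ?invr_gt0.
Qed.

(** With [s = 1] in the infimum, [p x <= |x + d| - 1] and [p (- x) <= |x - c| - 1];
the sum of the right-hand sides is arbitrarily small, while subadditivity gives
[0 <= p x + p (- x)]. *)
Lemma supportN x : support (- x) = - support x.
Proof.
suff sub0 y : `|y| = 1 -> support y + support (- y) <= 0.
  have [->|x0] := eqVneq x 0; first by rewrite oppr0 support0 oppr0.
  have nx0 : 0 < `|x| by rewrite normr_gt0.
  have : support (`|x|^-1 *: x) + support (- (`|x|^-1 *: x)) <= 0.
    by apply: sub0; rewrite normrZ ger0_norm ?invr_ge0// mulVf ?gt_eqF.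
  rewrite -scalerN !support_homo ?invr_gt0// -mulrDr pmulr_rle0 ?invr_gt0//.
  by have := support_subadditive x (- x); rewrite subrr support0; lra.
move=> y1; apply/ler_addgt0Pl => e e0; rewrite addr0.
have [c [d [Dc Dd ycd]]] := btw y1 e0.
have := support_le y Dd ltr01; have := support_le (- y) Dc ltr01.
by rewrite !scale1r -[`|- y + c|]normrN opprD opprK; lra.
Qed.

Lemma supportD x y : support (x + y) = support x + support y.
Proof.
apply/le_anti; rewrite support_subadditive/=.
have := support_subadditive (- x) (- y); rewrite -opprD !supportN; lra.
Qed.

Lemma supportZ t x : support (t *: x) = t * support x.
Proof.
have [t0|t0|->] := ltrgtP t 0; last by rewrite scale0r support0 mul0r.
- by rewrite -{1}[t]opprK scaleNr supportN support_homo ?oppr_gt0// mulNr opprK.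
- exact: support_homo.
Qed.

Lemma support_in x : D x -> support x = 1.
Proof.
move=> Dx; apply/le_anti; rewrite -{1}(D1 Dx) support_le_norm/=.
have := support_le (- x) Dx ltr01; rewrite supportN scale1r addNr normr0; lra.
Qed.

End support.

Lemma minimal_star_face (R : realType) (V : normedModType R) (h : V) :
  minimal_star h -> sphere_between (star h) -> generating_face (star h).
Proof.
move=> mh btw; have [h1 _] := mh.
by split=> //; [exact: star_sphere|exact: star_nonempty|exact: minimal_star_convex].
Qed.

Lemma linear_of (R : realType) (V W : lmodType R) (f : V -> W) :
  linear f -> exists F : {linear V -> W}, F =1 f.
Proof.
move=> flin; pose flinM := GRing.isLinear.Build R V W *:%R f flin.
by pose F : {linear V -> W} := HB.pack f flinM; exists F.
Qed.

(** * Isometries between spheres *)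

Section sphere_isometry.
Context {R : realType} {V W : normedModType R} (T : V -> W).
Hypothesis TS : T @` unit_sphere V = unit_sphere W.
Hypothesis Tiso :
  forall x y, unit_sphere V x -> unit_sphere V y -> `|T x - T y| = `|x - y|.
Implicit Types (x y h k c g z : V).

Lemma sphere_isometry_norm1 x : `|x| = 1 -> `|T x| = 1.
Proof. by move=> x1; rewrite -[_ = _]/(unit_sphere W (T x)) -TS; exists x. Qed.
Let T1 := sphere_isometry_norm1.

Lemma sphere_isometry_onto (y : W) : `|y| = 1 -> exists2 x, `|x| = 1 & T x = y.
Proof. by rewrite -[`|y| = 1]/(unit_sphere W y) -TS => -[x x1 <-]; exists x. Qed.
Let Tsurj := sphere_isometry_onto.

(** Both sides say that the two points are at distance 2. *)
Lemma sphere_isometry_star x z : `|x| = 1 -> `|z| = 1 ->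
  star (T x) (- T z) <-> star x (- z).
Proof. by move=> x1 z1; rewrite /star/= !normrN Tiso// z1 T1. Qed.
Let Tstar := sphere_isometry_star.

Lemma sphere_isometry_minimal h : minimal_star h -> minimal_star (T h).
Proof.
move=> [h1 mh]; split; first exact: T1.
move=> _ /Tsurj[k k1 <-] kh.
have hk : star h `<=` star k.
  apply: mh => // x kx; have [x1 _] := kx.
  rewrite -[x]opprK; apply/Tstar; rewrite ?normrN//; apply: kh.
  by apply/Tstar; rewrite ?normrN// opprK.
move=> v hv; have [v1 _] := hv.
have [z z1 Tz] : exists2 z, `|z| = 1 & T z = - v by apply: Tsurj; rewrite normrN.
by move: hv; rewrite -[v]opprK -Tz => /Tstar hz; apply/Tstar/hk/hz.
Qed.
Let Tmin := sphere_isometry_minimal.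

Lemma sphere_isometry_starN h c : `|h| = 1 -> star h c -> star (T h) (- T (- c)).
Proof.
by move=> h1 hc; have [c1 _] := hc; apply/Tstar; rewrite ?normrN// opprK.
Qed.
Let TstarN := sphere_isometry_starN.

(** The metric characterization of stars only yields [T c] in [- star (T (- h))].
But [T h] and [- T (- h)] have minimal stars, the first of which contains
[- T (- h)], so these stars coincide. *)
Lemma sphere_isometry_image_star h c :
  minimal_star h -> star h c -> star (T h) (T c).
Proof.
move=> mh hc; have [h1 _] := mh.
have mhN := minimal_starN mh.
rewrite (@minimal_star_eq _ _ _ (- T (- h))).
- apply/starN/Tstar; rewrite ?normrN//; first by case: hc.
  by apply/starN; rewrite opprK.
- exact: Tmin.
- by apply: minimal_starN; apply: Tmin.
- by apply: TstarN => //; exact: star_self.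
Qed.
Let Tim := sphere_isometry_image_star.

Lemma sphere_isometry_face h : minimal_star h ->
  generating_face (star h) -> generating_face (star (T h)).
Proof.
move=> mh [_ _ _ btw]; apply: minimal_star_face; first exact: Tmin.
move=> _ /Tsurj[x x1 <-] e e0; have [c [d [hc hd xcd]]] := btw x x1 e e0.
exists (T c), (- T (- d)); split; [exact: Tim|apply: TstarN => //; by case: mh|].
have [c1 _] := hc; have [d1 _] := hd.
by rewrite !Tiso//= ?opprK//= /unit_sphere/= normrN.
Qed.

(** For [c] and [d] with [|x - c| + |x + d| <= 2 + e], each of the two functionals
takes at [x], or at [T x], a value between [1 - |x - c|] and [|x + d| - 1], an
interval of length at most [e]. *)
Lemma sphere_isometry_support h x : minimal_star h ->
  generating_face (star h) -> `|x| = 1 ->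
  support_functional (star (T h)) (T x) = support_functional (star h) x.
Proof.
move=> mh face x1; have [h1 _] := mh; have [_ _ _ btw] := face.
have Tface := sphere_isometry_face mh face.
suff close e : 0 < e ->
    `|support_functional (star (T h)) (T x) - support_functional (star h) x| <= e.
  apply/eqP; rewrite -subr_eq0 -normr_le0.
  by apply/ler_addgt0Pl => e e0; rewrite addr0 close.
move=> e0; have [c [d [hc hd xcd]]] := btw x x1 e e0.
have [c1 _] := hc; have [d1 _] := hd; have dN1 : `|- d| = 1 by rewrite normrN.
have xc : `|- x + c| = `|x - c| by rewrite addrC distrC.
have Txc : `|- T x + T c| = `|x - c| by rewrite addrC distrC Tiso.
have Txd : `|T x - T (- d)| = `|x + d| by rewrite Tiso// opprK.
have := support_le face x hd ltr01; have := support_le face (- x) hc ltr01.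
have := support_le Tface (T x) (TstarN h1 hd) ltr01.
have := support_le Tface (- T x) (Tim mh hc) ltr01.
rewrite !scale1r xc Txc Txd (supportN face) (supportN Tface) ler_norml.
by move: xcd; lra.
Qed.

End sphere_isometry.

Definition star_cover (R : realType) (V : normedModType R) :=
  forall x : V, `|x| = 1 ->
    exists h, [/\ minimal_star h, generating_face (star h) & star h x].

(** The extension [f] of [T] is linear because the functionals supporting the faces
[star (T h)] pull back along [f] to the linear functionals supporting the faces
[star h], and they separate points: every unit vector of [W] is in one of these
faces, where the functional is 1. *)
Theorem Mazur_Ulam_of_star_cover (R : realType) (V : completeNormedModType R) :
  star_cover V -> Mazur_Ulam_property V.
Proof.
move=> cov W T TS Tiso.
have normalized (U : normedModType R) (x : U) : x != 0 -> `|(`|x|^-1 *: x)| = 1.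
  by move=> x0; rewrite normrZ ger0_norm ?invr_ge0// mulVf ?normr_eq0.
have polar (U : normedModType R) (x : U) : x != 0 -> `|x| *: (`|x|^-1 *: x) = x.
  by move=> x0; rewrite scalerA divff ?scale1r// normr_eq0.
pose f x := `|x| *: T (`|x|^-1 *: x).
have f1 x : `|x| = 1 -> f x = T x by move=> x1; rewrite /f x1 invr1 !scale1r.
have f0 : f 0 = 0 by rewrite /f normr0 scale0r.
have fnorm x : `|f x| = `|x|.
  have [->|x0] := eqVneq x 0; first by rewrite f0 !normr0.
  by rewrite normrZ normr_id (sphere_isometry_norm1 TS) ?mulr1// normalized.
have fsupport h x : minimal_star h -> generating_face (star h) ->
    support_functional (star (T h)) (f x) = support_functional (star h) x.
  move=> mh face; have Tface := sphere_isometry_face TS Tiso mh face.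
  have [->|x0] := eqVneq x 0; first by rewrite f0 !support0.
  rewrite -[in RHS](polar _ x x0) (supportZ face) /f (supportZ Tface).
  by rewrite (sphere_isometry_support TS Tiso mh face)// normalized.
have separating y : (forall h, minimal_star h -> generating_face (star h) ->
    support_functional (star (T h)) y = 0) -> y = 0.
  move=> y0; apply/eqP/negPn/negP => yn0.
  have [x x1 Tx] := sphere_isometry_onto TS (normalized _ _ yn0).
  have [h [mh face hx]] := cov x x1.
  have Tface := sphere_isometry_face TS Tiso mh face.
  have := support_in Tface (sphere_isometry_image_star TS Tiso mh hx).
  by rewrite Tx supportZ// y0// mulr0 => /eqP; rewrite eq_sym oner_eq0.
have flin : linear f.
  move=> t x y; apply/eqP; rewrite -subr_eq0; apply/eqP/separating => h mh face.
  have Tface := sphere_isometry_face TS Tiso mh face.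
  rewrite (supportD Tface) (supportN Tface) (supportD Tface).
  rewrite (supportZ Tface t (f x)) !fsupport//.
  by rewrite (supportD face) (supportZ face) subrr.
have [F Ff] := linear_of flin; exists F; split.
- by move=> z; rewrite Ff.
- apply/seteqP; split=> // y _; have [->|y0] := eqVneq y 0.
    by exists 0; rewrite // linear0.
  have [x x1 Tx] := sphere_isometry_onto TS (normalized _ _ y0).
  by exists (`|y| *: x) => //; rewrite linearZ/= Ff f1// Tx polar.
- by move=> z z1; rewrite Ff f1.
Qed.

(** * Maximal convex subsets of the sphere *)

Section maximal_convex.
Context {R : realType} {V : normedModType R}.
Implicit Types (C : set V) (x y c : V) (s t e : R).

Lemma exists_maximal_convex x : `|x| = 1 ->
  exists2 C, maximal_convex_subset (unit_sphere V) C & C x.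
Proof.
move=> x1.
(* Membership of x is required of nonempty sets only, so that P also holds of
   the union of the empty chain. *)
pose P C := [/\ convex_set C, C `<=` unit_sphere V & C !=set0 -> C x].
have Pchain (F : set (set V)) : F `<=` P -> total_on F subset ->
    P (\bigcup_(A in F) A).
  move=> FP Ftot; split.
  - apply/convex_setP => u v s t [A FA Au] [B FB Bv] s0 t0 st.
    have [AB|BA] := Ftot A B FA FB.
      exists B => //; have [/convex_setP cB _ _] := FP B FB.
      by apply: cB => //; exact: AB.
    exists A => //; have [/convex_setP cA _ _] := FP A FA.
    by apply: cA => //; exact: BA.
  - by move=> u [A FA Au]; have [_ AS _] := FP A FA; exact: AS.
  - move=> [u [A FA Au]]; exists A => //; have [_ _ Ax] := FP A FA.
    by apply: Ax; exists u.
have [C [[cC CS Cx] Cmax]] := Zorn_bigcup Pchain.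
have C0 : C !=set0.
  apply/set0P/negP => /eqP C0; apply: (Cmax [set x]).
    by rewrite C0; split=> // /(_ x); exact.
  split=> [|_ ->//|_ //].
  by apply/convex_setP => u v s t -> -> _ _ st; rewrite -scalerDl st scale1r.
exists C; last exact: Cx.
split=> // D cD DS CD; apply: (Cmax D CD); split=> // _.
by apply: (proj1 CD); exact: Cx.
Qed.

Lemma norm_segment x y s t : `|x| = 1 -> `|y| = 1 -> `|x + y| = 2 ->
  0 <= s -> 0 <= t -> s + t = 1 -> `|s *: x + t *: y| = 1.
Proof.
wlog ts : x y s t / t <= s => [wlg|].
  have [/wlg|/ltW st x1 y1 xy s0 t0 st1] := leP t s; first exact.
  by rewrite addrC wlg// addrC.
move=> x1 y1 xy s0 t0 st; apply/le_anti/andP; split.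
  by rewrite (le_trans (ler_normD _ _))// !normrZ x1 y1 !ger0_norm//; lra.
have := ler_normD (s *: x + t *: y) ((s - t) *: y).
have -> : s *: x + t *: y + (s - t) *: y = s *: (x + y) by linear_identity x y x x.
by rewrite !normrZ xy y1 !ger0_norm//; lra.
Qed.

(** The union of the segments from [y] to the points of [C] is then a convex subset
of the sphere that contains [C]. *)
Lemma maximal_convex_mem C y :
  maximal_convex_subset (unit_sphere V) C -> `|y| = 1 ->
  (forall c, C c -> `|c + y| = 2) -> C y.
Proof.
move=> [cC CS Cmax] y1 Cy2; apply: contrapT => Cy.
have [[c0 Cc0]|C0] := pselect (C !=set0); last first.
  apply: (Cmax [set y]); last first.
  - split=> [c Cc|/(_ y)]; first by case: C0; exists c.
    by apply: contra_not Cy; exact.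
  - by move=> _ ->.
  - by apply/convex_setP => u v s t -> -> _ _ st; rewrite -scalerDl st scale1r.
pose D := [set z | exists c s t,
  [/\ C c, 0 <= s, 0 <= t, s + t = 1 & z = s *: c + t *: y]].
apply: (Cmax D).
- apply/convex_setP => _ _ a b [c [s [t [Cc s0 t0 st ->]]]]
    [d [s' [t' [Cd s'0 t'0 st' ->]]]] a0 b0 ab.
  have [e Ce acbd] := convex_cone cC Cc Cd (mulr_ge0 a0 s0) (mulr_ge0 b0 s'0).
  exists e, (a * s + b * s'), (a * t + b * t'); split=> //; [nra..|].
  by rewrite -acbd; linear_identity c d y y.
- move=> _ [c [s [t [Cc s0 t0 st ->]]]].
  by apply: norm_segment => //; [exact: CS|exact: Cy2].
- split=> [c Cc|]; first exists c, 1, 0.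
    by split=> //; [lra|linear_identity c y c c].
  move=> /(_ y); apply: contra_not Cy; apply.
  by exists c0, 0, 1; split=> //; [lra|linear_identity c0 y y y].
Qed.

(** The sequence is indexed by pairs of a point [a] of a countable dense set and a
radius [1 / (k + 1)]: it picks a point of [C] that close to [a], if any. *)
Lemma separable_dense_sequence C : separable V -> C !=set0 ->
  exists c : nat -> V, (forall n, C (c n)) /\
    forall x, C x -> forall e, 0 < e -> exists n, `|x - c n| < e.
Proof.
move=> [A [/countable_injP[f finj] dA]] [c0 Cc0].
pose close a k c := C c /\ `|a - c| < k.+1%:R^-1.
have /choice[c cP] : forall n, exists c, C c /\ forall a (k : nat), A a ->
    n = pickle (f a, k) -> (exists c', close a k c') -> close a k c.
  move=> n.
  have [[a [k [Aa nak [c ac]]]]|none] :=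
    pselect (exists a k, [/\ A a, n = pickle (f a, k) & exists c, close a k c]).
    exists c; split; first by case: ac.
    move=> b l Ab; rewrite nak => /(pcan_inj pickleK)[fab <-] _.
    by rewrite -(finj a b (mem_set Aa) (mem_set Ab) fab).
  exists c0; split=> // a k Aa nak ex; case: none.
  by exists a, k; split.
exists c; split=> [n|x Cx e e0]; first by case: (cP n).
have [k ke] : exists k, 0 + k.+1%:R^-1 < e / 2.
  by apply: ltr_add_invr; rewrite divr_gt0.
rewrite add0r in ke; have k0 : 0 < k.+1%:R^-1 :> R by rewrite invr_gt0.
have [a [xa Aa]] := dA (ball x k.+1%:R^-1)
  (ex_intro _ x (ballxx x k0)) (ball_open x _).
move: xa; rewrite -ball_normE/= => xa.
have [_ /(_ a k Aa erefl)[]] := cP (pickle (f a, k)).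
  by exists x; split=> //; rewrite distrC.
move=> _ ac; exists (pickle (f a, k)).
have := ler_distD a x (c (pickle (f a, k))).
by move: (lt_trans xa ke) (lt_trans ac ke); lra.
Qed.

(** The set of the [s c - t d] with [c], [d] in [C] is convex, so [x] is close to
some [s c - t d].  Then [x - c] and [x + d] are close to [- t (c + d)] and
[s (c + d)], whose norms add up to at most 2. *)
Lemma almost_CL_sphere_between C :
  unit_ball V = closure (convex_hull (C `|` -%R @` C)) ->
  maximal_convex_subset (unit_sphere V) C -> sphere_between C.
Proof.
move=> BC [cC CS _] x x1 e e0.
have : unit_ball V x by rewrite /unit_ball/= x1.
rewrite BC => /(_ (ball x (e / 2)))[]; first by apply: nbhsx_ballx; rewrite divr_gt0.
move=> p [hp]; rewrite -ball_normE/= => xp.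
pose P := [set p | exists c d s t,
  [/\ C c, C d, 0 <= s /\ 0 <= t, s + t = 1 & p = s *: c - t *: d]].
have [c [d [s [t [Cc Cd [s0 t0] st pE]]]]] : P p.
  have [C0|/nonemptyPn C0] := pselect (C !=set0); last first.
    by move: hp; rewrite C0 image_set0 setU0 => /(_ set0)[]; split.
  apply: hp; split; last first.
    move=> q [Cq|[c Cc <-]].
      by exists q, q, 1, 0; split; rewrite ?scale1r ?scale0r ?subr0//; lra.
    by exists c, c, 0, 1; split; rewrite // ?scale0r ?scale1r ?sub0r//; lra.
  apply/convex_setP => _ _ a b [c [d [s [t [Cc Cd [s0 t0] st ->]]]]]
    [c' [d' [s' [t' [Cc' Cd' [s'0 t'0] st' ->]]]]] a0 b0 ab.
  have [u Cu uE] := convex_cone cC Cc Cc' (mulr_ge0 a0 s0) (mulr_ge0 b0 s'0).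
  have [v Cv vE] := convex_cone cC Cd Cd' (mulr_ge0 a0 t0) (mulr_ge0 b0 t'0).
  exists u, v, (a * s + b * s'), (a * t + b * t'); split=> //; [nra..|].
  by rewrite -uE -vE; linear_identity c d c' d'.
exists c, d; split=> //.
have c1 := CS c Cc; have d1 := CS d Cd.
have := ler_normD (x - p) (- t *: (c + d)); have := ler_normD (x - p) (s *: (c + d)).
have -> : x - p + - t *: (c + d) = x - c.
  by rewrite pE (_ : s = 1 - t); [linear_identity x c d d|lra].
have -> : x - p + s *: (c + d) = x + d.
  by rewrite pE (_ : t = 1 - s); [linear_identity x c d d|lra].
have := ler_normD c d; rewrite c1 d1 => cd2.
rewrite !normrZ normrN !ger0_norm//; nra.
Qed.

End maximal_convex.

(** * Separable almost-CL-spaces *)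

Section separable_space.
Context {R : realType} {V : completeNormedModType R}.
Implicit Types (C : set V) (x y : V).

(** The centre [h] is an infinite convex combination of a dense sequence [c] in [C]
with positive weights.  If [|h + y| = 2], no term can lose norm when [y] is
added, so [|c n + y| = 2] for all [n], and by density [y] is at distance 2 from
the opposite of every point of [C]. *)
Lemma maximal_convex_is_star C : separable V ->
  maximal_convex_subset (unit_sphere V) C -> C !=set0 ->
  exists2 h, `|h| = 1 & star h = C.
Proof.
move=> sepV maxC C0; have [cC CS _] := maxC.
have [y0 Cy0] := C0.
have [c [Cc c_dense]] := separable_dense_sequence sepV C0.
pose q : R := 2^-1.
have q0 n : 0 < q ^+ n by rewrite exprn_gt0// invr_gt0.
have qS n : q ^+ n = q ^+ n.+1 + q ^+ n.+1.
  by rewrite exprS; move: (q ^+ n) => r; rewrite /q; lra.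
pose u n := q ^+ n.+1 *: c n.
pose S := series u.
have SS n : S n.+1 = S n + u n by rewrite /S /series/= big_nat_recr.
have un n : `|u n| = q ^+ n.+1 by rewrite normrZ (CS _ (Cc n)) mulr1 gtr0_norm.
have [h Sh] : exists h : V, S @ \oo --> h.
  suff cS : cvgn S by exists (lim (S @ \oo)).
  apply: normed_cvg; suff : cvgn (series (fun n => `|u n|)) by [].
  rewrite (_ : (fun n => `|u n|) = geometric q q).
    apply: is_cvg_geometric_series; rewrite gtr0_norm ?invr_gt0//.
    by rewrite invf_lt1// ltr1n.
  by apply/funext => n /=; rewrite un exprS.
(* The missing weight q ^+ n of the partial sum is put on y, to stay in C. *)
have zC n y : C y -> C (S n + q ^+ n *: y).
  elim: n y => [|n IH] y Cy; first by rewrite /S /series/= big_geq// add0r scale1r.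
  have /IH : C (q *: c n + q *: y).
    by move/convex_setP: cC; apply=> //; rewrite -?mulrDl /q; lra.
  by rewrite SS /u scalerDr !scalerA -exprSr addrA.
have zh y : S n + q ^+ n *: y @[n --> \oo] --> h.
  rewrite -[h]addr0; apply: cvgD => //; rewrite -(scale0r y).
  apply: cvgZr_tmp; rewrite exprn_geometric.
  by apply: cvg_geometric; rewrite gtr0_norm ?invr_gt0// invf_lt1// ltr1n.
have h1 : `|h| = 1.
  have : `|S n + q ^+ n *: y0| @[n --> \oo] --> `|h| by exact: cvg_norm.
  rewrite (_ : (fun n => _) = cst 1); last by apply/funext => n; apply/CS/zC.
  by move=> /(cvg_lim (@Rhausdorff R)); rewrite lim_cst// => <-.
exists h => //; apply/seteqP; split=> [y [y1 hy]|y Cy].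
- apply: (maximal_convex_mem maxC y1) => x Cx.
  have tail m k : `|S (m.+1 + k)%N - u m| <= 1 - q ^+ m.+1 - q ^+ (m.+1 + k)%N.
    have partial : `|S m| <= 1 - q ^+ m.
      elim: m => [|m IH]; first by rewrite /S /series/= big_geq// normr0 expr0 subrr.
      rewrite SS (le_trans (ler_normD _ _))// un; have := qS m; lra.
    elim: k => [|k IH].
      by rewrite addn0 SS addrK (le_trans partial)//; have := qS m; lra.
    rewrite addnS SS addrAC (le_trans (ler_normD _ _))// un.
    by have := qS (m.+1 + k)%N; lra.
  have hu m : `|h - u m| <= 1 - q ^+ m.+1.
    apply/ler_addgt0Pr => e e0.
    have /cvgrPdist_lt/(_ e e0)[N _ SN] := Sh.
    have := SN (m.+1 + N)%N (leq_addl _ _) => /= hSe.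
    have := ler_distD (S (m.+1 + N)%N) h (u m).
    have := tail m N; have := q0 (m.+1 + N)%N; lra.
  (* h + y is the sum of h - u m, q ^+ m.+1 *: (c m + y) and
     (1 - q ^+ m.+1) *: y, where the first and the last have norm at most
     1 - q ^+ m.+1. *)
  have cy2 m : 2 <= `|c m + y|.
    have := ler_normD (h - u m) (q ^+ m.+1 *: (c m + y) + (1 - q ^+ m.+1) *: y).
    have := ler_normD (q ^+ m.+1 *: (c m + y)) ((1 - q ^+ m.+1) *: y).
    have -> : h - u m + (q ^+ m.+1 *: (c m + y) + (1 - q ^+ m.+1) *: y) = h + y.
      by rewrite /u; linear_identity h (c m) y y.
    have := hu m; have qm := q0 m.+1; have := normr_ge0 (h - u m).
    move=> hu0 hum; rewrite !normrZ hy y1 gtr0_norm// ger0_norm; last by lra.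
    move=> le1 le2; rewrite -(ler_pM2l qm); lra.
  apply/le_anti/andP; split.
    by rewrite (le_trans (ler_normD _ _))// (CS x Cx) y1.
  apply/ler_addgt0Pr => e e0; have [m xm] := c_dense x Cx e e0.
  have := ler_normD (x + y) (c m - x).
  have -> : x + y + (c m - x) = c m + y by linear_identity x y (c m) x.
  by have := cy2 m; rewrite [`|c m - x|]distrC; lra.
- split; first exact: CS.
  have : `|S n + q ^+ n *: y + y| @[n --> \oo] --> `|h + y|.
    by apply: cvg_norm; apply: cvgD => //; exact: cvg_cst.
  rewrite (_ : (fun n => _) = cst 2); last first.
    apply/funext => n /=.
    have /CS w1 : C (2^-1 *: (S n + q ^+ n *: y) + 2^-1 *: y).
      by move/convex_setP: cC; apply=> //; [exact: zC|lra].
    have <- : 2 *: (2^-1 *: (S n + q ^+ n *: y) + 2^-1 *: y) = S n + q ^+ n *: y + y.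
      by linear_identity (S n) y y y.
    by rewrite norm_double w1 mulr1.
  by move=> /(cvg_lim (@Rhausdorff R)); rewrite lim_cst// => <-.
Qed.

Theorem separable_almost_CL_star_cover :
  separable V -> almost_CL_space V -> star_cover V.
Proof.
move=> sepV clV x x1; have [C maxC Cx] := exists_maximal_convex x1.
have [h h1 hC] := maximal_convex_is_star sepV maxC (ex_intro _ x Cx).
have btw := almost_CL_sphere_between (clV C maxC) maxC.
rewrite -hC in maxC Cx btw.
have mh := maximal_convex_minimal_star h1 maxC.
by exists h; split=> //; exact: minimal_star_face.
Qed.

End separable_space.

(** * Spaces of continuous functions *)

Section bump.
Context {R : realType} {K : metricType R}.
Implicit Types (r s t : K) (d : R).

Definition bump t d s : R := Num.max 0 (1 - mdist t s / d).

Lemma bump_ge0 t d s : 0 <= bump t d s.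
Proof. by rewrite le_max lexx. Qed.

Lemma bump_le1 t d s : 0 < d -> bump t d s <= 1.
Proof.
by move=> d0; rewrite ge_max ler01/= lerBlDr lerDl divr_ge0 ?mdist_ge0// ltW.
Qed.

Lemma bump_center t d : bump t d t = 1.
Proof. by rewrite /bump mdistxx mul0r subr0; apply/max_idPr. Qed.

Lemma bump_far t d s : 0 < d -> d <= mdist t s -> bump t d s = 0.
Proof. by move=> d0 ts; apply/max_idPl; rewrite subr_le0 ler_pdivlMr// mul1r. Qed.

Lemma bump_eq1 t d s : 0 < d -> 1 <= bump t d s -> s = t.
Proof.
move=> d0; rewrite le_max ler10/= -subr_ge0 addrAC subrr add0r oppr_ge0.
rewrite pmulr_lle0 ?invr_gt0// => ts; apply/esym/mdist_positivity/le_anti.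
by rewrite ts mdist_ge0.
Qed.

Lemma bump_continuous t d : continuous (bump t d).
Proof.
have dist_cont : continuous (mdist t).
  move=> s; apply/cvgrPdist_lt => e e0.
  have : \forall r \near s, ball s e r by exact: nbhsx_ballx.
  apply: filterS => r; rewrite ballEmdist/= => sr.
  rewrite (le_lt_trans _ sr)// ler_norml.
  have := metric_triangle t s r; have := metric_triangle t r s.
  by rewrite (metric_sym r s) => *; lra.
move=> s; apply: (@continuous_max _ _ (cst 0) (fun s => 1 - mdist t s / d)).
  exact: cvg_cst.
by apply: cvgB; [exact: cvg_cst|apply: cvgM; [exact: dist_cont|exact: cvg_cst]].
Qed.

End bump.

Section continuous_functions.
Context {R : realType} {K : metricType R} (cK : compact [set: K]).
Context {X : normedModType R}.
Local Notation E := (cspace cK X).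
Implicit Types (f g k : E) (x c : X) (s t : K) (d : R).

Lemma cspace_norm_attained f : `|f| != 0 -> exists t, `|f t| = `|f|.
Proof.
move=> f0; have [K0|K0] := pselect ([set: K] !=set0); last first.
  case/negP: f0; rewrite eq_le normr_ge0 andbT cspace_normE.
  by apply/sup_norm_le => // t; case: K0; exists t.
have fc : {within [set: K], continuous (fun t => `|f t|)}.
  apply: continuous_subspaceT => t; apply: cvg_norm.
  exact: cspace_continuous.
have [t _ ft] := compact_EVT_max K0 cK fc; exists t.
apply/le_anti; rewrite cspace_normE le_sup_norm/=.
by apply/sup_norm_le => // s; apply: ft; rewrite inE.
Qed.

Lemma blend_continuous t d f c :
  continuous (fun s => (1 - bump t d s) *: f s + bump t d s *: c).
Proof.
move=> s; apply: cvgD; apply: cvgZ.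
- by apply: cvgB; [exact: cvg_cst|exact: bump_continuous].
- exact: cspace_continuous.
- exact: bump_continuous.
- exact: cvg_cst.
Qed.

(** Since it is a pointwise convex combination of [f] and [c], blending keeps
functions in the unit ball while giving them the value [c] at [t]. *)
Definition blend t d f c : E := cspace_mk cK (@blend_continuous t d f c).

Lemma blend_norm_le1 t d f c :
  0 < d -> `|f| <= 1 -> `|c| <= 1 -> `|blend t d f c| <= 1.
Proof.
move=> d0 f1 c1; rewrite cspace_normE; apply/sup_norm_le => // s.
have b0 := bump_ge0 t d s; have b1 := bump_le1 t s d0.
rewrite (le_trans (ler_normD _ _))// !normrZ !ger0_norm ?subr_ge0//.
have fs1 : `|f s| <= 1 by exact: le_trans (le_sup_norm f s) f1.
nra.
Qed.

Lemma blend_center t d f c : blend t d f c t = c.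
Proof. by rewrite /blend cspace_mkE bump_center subrr scale0r add0r scale1r. Qed.

Lemma unit_of_value f t : `|f| <= 1 -> `|f t| = 1 -> `|f| = 1.
Proof. by move=> f1 ft1; apply/le_anti; rewrite f1 -ft1; exact: le_sup_norm. Qed.

Definition peak t d x : E := blend t d 0 x.

Lemma peakE t d x s : peak t d x s = bump t d s *: x.
Proof. by rewrite /peak /blend cspace_mkE scaler0 add0r. Qed.

Lemma peak_norm t d x : 0 < d -> `|x| = 1 -> `|peak t d x| = 1.
Proof.
move=> d0 x1; apply: (@unit_of_value _ t); last by rewrite blend_center.
by apply: blend_norm_le1; rewrite ?normr0 ?x1.
Qed.

(** By compactness [peak t d x + f] attains its norm 2, which forces the bump to be 1
at that point, hence the point to be [t]. *)
Lemma star_peak t d x f : 0 < d -> `|x| = 1 ->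
  star (peak t d x) f <-> `|f| = 1 /\ star x (f t).
Proof.
move=> d0 x1; have h1 := peak_norm t d0 x1.
split=> [[f1 hf]|[f1 [ft1 xf]]]; last first.
  apply: norm_le_star => //; rewrite -xf -{1}(blend_center t d 0 x).
  exact: (le_sup_norm (peak t d x + f) t).
split=> //.
have [|s] := @cspace_norm_attained (peak t d x + f); first by rewrite hf.
rewrite hf cspaceDE peakE => hs.
have b0 := bump_ge0 t d s; have b1 := bump_le1 t s d0.
have fs1 : `|f s| <= 1 by rewrite -f1; exact: le_sup_norm.
have bx : `|bump t d s *: x| = bump t d s by rewrite normrZ x1 mulr1 ger0_norm.
have := ler_normD (bump t d s *: x) (f s); rewrite hs bx => le2.
have st : s = t by apply: (bump_eq1 d0); lra.
move: hs le2 fs1; rewrite st bump_center scale1r => hs le2 fs1.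
by split=> //; apply/le_anti; rewrite fs1; lra.
Qed.

(** Let the star of [k] be included in that of the peak, and let [k] attain its
norm at [s].  The unit functions whose value at [s] is in the star of [k s] are
in the star of [k].  If [s] differed from [t], one of them would vanish at [t];
so [s = t], and testing with peaks at [t] shows that the star of [k t] is
included in that of [x], hence equal to it. *)
Lemma peak_minimal t d x : 0 < d -> minimal_star x -> minimal_star (peak t d x).
Proof.
move=> d0 [x1 minx]; split; first exact: peak_norm.
move=> k k1 kh f /(star_peak _ _ d0 x1)[f1 xft].
have [|s ks] := @cspace_norm_attained k; first by rewrite k1 oner_eq0.
rewrite k1 in ks.
have star_k g : `|g| = 1 -> star (k s) (g s) -> star k g.
  move=> g1 [gs1 kgs]; apply: norm_le_star => //; rewrite -kgs.
  exact: (le_sup_norm (k + g) s).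
have st : s = t.
  apply/eqP/negPn/negP => st.
  have st0 : 0 < mdist s t by rewrite mdist_gt0.
  have : star k (peak s (mdist s t) (k s)).
    by apply: star_k; [exact: peak_norm|rewrite blend_center; exact: star_self].
  move=> /kh/(star_peak _ _ d0 x1)[_ []].
  by rewrite peakE bump_far// scale0r normr0 => /eqP; rewrite eq_sym oner_eq0.
rewrite st in ks star_k; apply: (star_k f) => //; apply: minx => // c kc.
have [c1 _] := kc; have d1 : 0 < 1 :> R by [].
have : star k (peak t 1 c).
  by apply: star_k; [exact: peak_norm|rewrite blend_center].
by move=> /kh/(star_peak _ _ d0 x1)[_]; rewrite blend_center.
Qed.

Lemma blend_dist t d f c e : 0 < d -> 0 <= e ->
  (forall s, mdist t s < d -> `|f s - f t| <= e) ->
  `|f - blend t d f c| <= `|f t - c| + e.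
Proof.
move=> d0 e0 fd; rewrite cspace_normE; apply/sup_norm_le => [|s].
  by rewrite addr_ge0.
have b0 := bump_ge0 t d s; have b1 := bump_le1 t s d0.
rewrite cspaceBE /blend cspace_mkE.
have -> : f s - ((1 - bump t d s) *: f s + bump t d s *: c) =
    bump t d s *: (f s - c).
  by linear_identity (f s) c c c.
have [ts|ts] := ltP (mdist t s) d; last first.
  by rewrite bump_far// scale0r normr0 addr_ge0.
rewrite normrZ ger0_norm//.
have := fd s ts; have := ler_distD (f t) (f s) c; have := normr_ge0 (f s - c).
by nra.
Qed.

End continuous_functions.

(** Writing [x = r u] with [u] on the sphere, [x - c] is [r (u - c) - (1 - r) c],
and likewise for [x + d]; the bound 2 is thus averaged with 2. *)
Lemma ball_between (R : realType) (V : normedModType R) (D : set V) x e :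
  D `<=` unit_sphere V -> D !=set0 -> sphere_between D -> `|x| <= 1 -> 0 < e ->
  exists c d, [/\ D c, D d & `|x - c| + `|x + d| <= 2 + e].
Proof.
move=> D1 [c0 Dc0] btw x1 e0; have [->|x0] := eqVneq x 0.
  by exists c0, c0; split=> //; rewrite sub0r add0r normrN (D1 _ Dc0); lra.
have nx0 : 0 < `|x| by rewrite normr_gt0.
have [|c [d [Dc Dd xcd]]] := btw (`|x|^-1 *: x) _ e e0.
  by rewrite normrZ ger0_norm ?invr_ge0// mulVf ?normr_eq0.
exists c, d; split=> //.
have xE : x = `|x| *: (`|x|^-1 *: x).
  by rewrite scalerA divff ?scale1r// normr_eq0.
set u := _ *: x in xE xcd; set r := `|x| in xE x1 nx0.
have -> : x - c = r *: (u - c) - (1 - r) *: c by rewrite xE; linear_identity u c c c.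
have -> : x + d = r *: (u + d) + (1 - r) *: d by rewrite xE; linear_identity u d d d.
have := ler_normB (r *: (u - c)) ((1 - r) *: c).
have := ler_normD (r *: (u + d)) ((1 - r) *: d).
rewrite !normrZ (D1 _ Dc) (D1 _ Dd) (gtr0_norm nx0).
rewrite (@ger0_norm _ (1 - r)) ?subr_ge0//.
nra.
Qed.

(** The star that contains [f] is centred at a peak over a point [t] where [f]
attains its norm.  For the metric segments through [g], blending lifts the points
[c] and [c'] of [X] found for the value [g t], which may be inside the ball. *)
Theorem star_cover_cspace (R : realType) (K : metricType R)
    (cK : compact [set: K]) (X : normedModType R) :
  star_cover X -> star_cover (cspace cK X).
Proof.
move=> cov f f1.
have [|t ft] := @cspace_norm_attained _ _ cK _ f; first by rewrite f1 oner_eq0.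
rewrite f1 in ft; have [x [mx [xS x0 _ btw] xft]] := cov _ ft.
have [x1 _] := mx; have d1 : 0 < 1 :> R by [].
have mh := peak_minimal cK t d1 mx.
exists (peak cK t 1 x); split=> //; last by apply/star_peak.
apply: minimal_star_face => // g g1 e e0.
have gt1 : `|g t| <= 1 by rewrite -g1; exact: le_sup_norm.
have e30 : 0 < e / 3 by rewrite divr_gt0.
have [c [c' [xc xc' gcc']]] := ball_between xS x0 btw gt1 e30.
have [d d0 gd] : exists2 d, 0 < d & forall s, mdist t s < d -> `|g s - g t| <= e / 3.
  have /cvgrPdist_lt/(_ _ e30) := @cspace_continuous _ _ cK _ g t.
  move=> /nbhs_ballP[d /= d0 gd]; exists d => // s ts.
  by rewrite distrC ltW//; apply: gd; rewrite ballEmdist.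
have blend_star k b : `|k| = 1 -> star x b ->
    star (peak cK t 1 x) (blend t d k b).
  move=> k1 xb; have [b1 _] := xb; apply/star_peak; rewrite // blend_center.
  split=> //; apply: (@unit_of_value _ _ _ _ _ t); rewrite ?blend_center//.
  by rewrite blend_norm_le1 ?k1 ?b1.
exists (blend t d g c), (blend t d (- g) c'); split; [exact: blend_star| |].
  by apply: blend_star => //; rewrite normrN.
have gdN s : mdist t s < d -> `|(- g) s - (- g) t| <= e / 3.
  by move=> /gd; rewrite !cspaceNE -opprD normrN.
have := blend_dist c d0 (ltW e30) gd; have := blend_dist c' d0 (ltW e30) gdN.
rewrite -opprD normrN cspaceNE -opprD normrN; lra.
Qed.

Theorem proposition2p14 (R : realType) (K : metricType R)
    (cK : compact [set: K]) (X : completeNormedModType R) :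
  separable X -> almost_CL_space X ->
  Mazur_Ulam_property (cspace cK X).
Proof.
move=> sepX clX; apply: Mazur_Ulam_of_star_cover.
exact: star_cover_cspace (separable_almost_CL_star_cover sepX clX).
Qed.
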